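(* The permutation statistic $\operatorname{maj}$ (major index) is shuffle compatible.
   Context: For a finite set $U$ of positive integers, a permutation of $U$ is a linear order $\pi=\pi_1\pi_2\cdots\pi_m$ of all the elements of $U$ (each appearing exactly once); write $\operatorname{dom}(\pi)=U$, $|\pi|=|U|=m$, and let $L(U)$ be the set of permutations of $U$. Two permutations $\pi\in L(U)$, $\pi'\in L(V)$ with $|U|=|V|$ have the same relative order if applying the unique strictly increasing bijection $U\to V$ to the entries of $\pi$ gives $\pi'$. A permutation statistic is a map $\operatorname{St}$ defined on all permutations of all finite sets of positive integers such that $\operatorname{St}(\pi)=\operatorname{St}(\pi')$ whenever $\pi$ and $\pi'$ have the same relative order. For permutations $\pi,\sigma$ with disjoint domains, the shuffle set $\operatorname{Sh}(\pi,\sigma)$ is the set of all $\tau\in L(\operatorname{dom}(\pi)\sqcup\operatorname{dom}(\sigma))$ containing both $\pi$ and $\sigma$ as (not necessarily contiguous) subwords. For a set $\Pi$ of permutations, $\operatorname{St}(\Pi)$ denotes the multiset $\{\{\operatorname{St}(\pi) : \pi\in\Pi\}\}$. A permutation statistic $\operatorname{St}$ is shuffle compatible if for all permutations $\pi,\pi',\sigma,\sigma'$ with $|\pi|=|\pi'|$, $|\sigma|=|\sigma'|$, $\operatorname{dom}(\pi)\cap\operatorname{dom}(\sigma)=\operatorname{dom}(\pi')\cap\operatorname{dom}(\sigma')=\emptyset$, $\operatorname{St}(\pi)=\operatorname{St}(\pi')$ and $\operatorname{St}(\sigma)=\operatorname{St}(\sigma')$, one has the equality of multisets $\operatorname{St}(\operatorname{Sh}(\pi,\sigma))=\operatorname{St}(\operatorname{Sh}(\pi',\sigma'))$.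 For $\pi=\pi_1\cdots\pi_m$: $\operatorname{Des}(\pi)=\{i\in[m-1] : \pi_i>\pi_{i+1}\}$ and $\operatorname{maj}(\pi)=\sum_{i\in\operatorname{Des}(\pi)} i$. *)

(* Defs.v *)
From HB Require Import structures.
From mathcomp Require Import all_boot finmap multiset.

Set Implicit Arguments.
Unset Strict Implicit.
Unset Printing Implicit Defensive.

Local Open Scope nat_scope.
Local Open Scope fset_scope.

(* A permutation of a finite set of positive integers is its word. *)
Record permutation := Permutation {
  word :> seq nat;
  _ : uniq word && all (leq 1) word }.

HB.instance Definition _ := [isSub for word].
HB.instance Definition _ := [Choice of permutation by <:].

Definition dom (p : permutation) : {fset nat} := [fset x in word p].

Definition L (U : {fset nat}) : {fset permutation} :=
  [fset p in pmap insub (permutations (enum_fset U))].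

Lemma in_L (U : {fset nat}) (p : permutation) : (p \in L U) = (dom p == U).
Proof.
have up : uniq p by case: p => s /= /andP[].
rewrite in_fset /= mem_pmap_sub mem_permutations.
apply/idP/eqP => [/perm_mem pU | <-].
  by apply/fsetP => x; rewrite in_fset; apply: pU.
by apply: uniq_perm; rewrite ?fset_uniq // => x; rewrite in_fset.
Qed.

Definition same_relative_order (p q : permutation) : Prop :=
  exists f : nat -> nat,
    [/\ {in dom p &, {homo f : x y / x < y}},
        f @` dom p = dom q & map f p = q].

Record perm_statistic (T : choiceType) := PermStatistic {
  stat_fun :> permutation -> T;
  _ : forall p q : permutation,
        same_relative_order p q -> stat_fun p = stat_fun q }.

Definition Sh (p q : permutation) : {fset permutation} :=
  [fset t in L (dom p `|` dom q) | subseq p t && subseq q t].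

Lemma in_Sh (p q t : permutation) :
  (t \in Sh p q) = [&& dom t == dom p `|` dom q, subseq p t & subseq q t].
Proof. by rewrite in_fset /= inE /= in_L. Qed.

Definition stat_mset (T : choiceType) (St : permutation -> T)
    (P : {fset permutation}) : {mset T}%mset :=
  seq_mset [seq St p | p <- enum_fset P].

Definition shuffle_compatible (T : choiceType) (St : perm_statistic T) : Prop :=
  forall p p' q q' : permutation,
    size p = size p' -> size q = size q' ->
    dom p `&` dom q = fset0 -> dom p' `&` dom q' = fset0 ->
    St p = St p' -> St q = St q' ->
    stat_mset St (Sh p q) = stat_mset St (Sh p' q').

(* Positions are numbered from 1: the i-th letter of p is nth 0 p i.-1. *)
Definition Des (p : permutation) : {fset nat} :=
  [fset i in iota 1 (size p).-1 | nth 0 p i.-1 > nth 0 p i].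

Definition maj_fun (p : permutation) : nat := \sum_(i <- enum_fset (Des p)) i.

Lemma maj_relative_order (p q : permutation) :
  same_relative_order p q -> maj_fun p = maj_fun q.
Proof.
case=> f [f_incr _ fpq]; rewrite /maj_fun; congr (\sum_(i <- enum_fset _) i).
have f_mono : {in dom p &, {mono f : x y / x < y}}.
  move=> x y xp yp; case: (ltngtP x y) => [xy|yx|<-]; rewrite ?ltnn //.
    exact: f_incr.
  by apply/negbTE; rewrite -leqNgt ltnW // f_incr.
apply/fsetP => i; rewrite !in_fset /= !inE -fpq size_map.
case: (boolP (i \in _)) => //=; rewrite mem_iota => /andP[i_gt0 i_lt].
have ip : i < size p by case: (size p) i_lt i_gt0 => [|n] //=; case: (i).
have i1p : i.-1 < size p by apply: leq_ltn_trans ip; apply: leq_pred.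
by rewrite !(nth_map 0) // f_mono // in_fset mem_nth.
Qed.

Definition maj : perm_statistic nat := PermStatistic maj_relative_order.

(* Main.v *)
From mathcomp Require Import all_boot all_algebra finmap multiset.
From mathcomp Require Import ring zify.
Require Import Defs.

Set Implicit Arguments.
Unset Strict Implicit.
Unset Printing Implicit Defensive.

Import GRing.Theory.
Local Open Scope nat_scope.

(** The generating function of [maj] over the shuffles of [p] and [r], of sizes
    [m] and [n], is [q ^ (maj p + maj r)] times the Gaussian binomial
    coefficient [m + n] choose [m]: it depends only on [m], [n], [maj p] and
    [maj r], which is shuffle compatibility.

    The formula is proved by removing the last letter of a shuffle. Let [x] and
    [y] be the last letters of the two words, say [y < x]. Appending one letter
    to a word of length [k] adds [k] to [maj] exactly when it creates a
    descent, which depends on the letter just before; so the induction must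
    keep track of the word that supplies the last letter. The shuffles that end
    in [x] and those that end in [y] contribute, up to the common factor
    [q ^ (maj p + maj r)],
      [m + n - 1] choose [m - 1]   and   [q ^ m] times [m + n - 1] choose [m],
    which add up to [m + n] choose [m] by Pascal's rule. Each of the two
    expressions follows from the formulas for shorter words. The letter before
    the final [x] is either [y], an ascent, or the predecessor of [x] in its own
    word; the letter before the final [y] is either [x], a descent, or the
    predecessor of [y] in its own word. If both candidates have the same effect,
    the formula for the total applies to what precedes the final letter. If they
    have opposite effects, the refined formulas apply, and the other form of
    Pascal's rule combines them ([last_letter_lawP]).

    Words are read from right to left, so that the last letter becomes the head
    of a list; [perm_Sh] and [maj_rmaj] translate back. *)

(** * Shuffles of words *)

Fixpoint shuffles (T : Type) (u : seq T) : seq T -> seq (seq T) :=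
  fix shuffles_u v :=
    match u, v with
    | [::], _ => [:: v]
    | _, [::] => [:: u]
    | x :: u', y :: v' =>
        [seq x :: t | t <- shuffles u' v] ++ [seq y :: t | t <- shuffles_u v']
    end.

Section Shuffles.
Variable T : eqType.
Implicit Types (x y : T) (u v t : seq T).

Lemma shuffles0s v : shuffles [::] v = [:: v].
Proof. by case: v. Qed.

Lemma shuffless0 u : shuffles u [::] = [:: u].
Proof. by case: u. Qed.

Lemma shuffles_cons x u y v :
  shuffles (x :: u) (y :: v) =
  [seq x :: t | t <- shuffles u (y :: v)] ++
  [seq y :: t | t <- shuffles (x :: u) v].
Proof. by []. Qed.

Lemma shufflesC u v : perm_eq (shuffles u v) (shuffles v u).
Proof.
elim: u v => [|x u IHu] v; first by rewrite shuffles0s shuffless0.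
elim: v => [|y v IHv]; first by rewrite shuffles0s shuffless0.
by rewrite !shuffles_cons perm_catC perm_cat ?perm_map.
Qed.

Lemma perm_shuffles u v t : t \in shuffles u v -> perm_eq t (u ++ v).
Proof.
elim: u v t => [|x u IHu] v t; first by rewrite shuffles0s inE => /eqP->.
elim: v t => [|y v IHv] t; first by rewrite shuffless0 inE cats0 => /eqP->.
rewrite shuffles_cons mem_cat => /orP[] /mapP[s s_in ->].
  by rewrite /= perm_cons IHu.
rewrite -cat_rcons -cats1 perm_sym perm_catAC perm_catC perm_cons perm_sym.
exact: IHv.
Qed.

Lemma uniq_cat_cons x u y v : uniq ((x :: u) ++ (y :: v)) ->
  [/\ x != y, uniq (u ++ y :: v) & uniq ((x :: u) ++ v)].
Proof.
move=> uv_uniq; have xuv_uniq : uniq ((x :: u) ++ v).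
  by apply: subseq_uniq uv_uniq; apply: cat_subseq => //; apply: subseq_cons.
move: uv_uniq; rewrite cat_cons /= mem_cat inE !negb_or.
by case/andP=> /and3P[_ xy _].
Qed.

Lemma uniq_shuffles u v : uniq (u ++ v) -> uniq (shuffles u v).
Proof.
elim: u v => [|x u IHu] v; first by rewrite shuffles0s.
elim: v => [|y v IHv]; first by rewrite shuffless0.
case/uniq_cat_cons=> xy /IHu uniq_u /IHv uniq_v.
rewrite shuffles_cons cat_uniq !map_inj_uniq ?uniq_u ?uniq_v; first last.
- by move=> ? ? [].
- by move=> ? ? [].
rewrite andbT; apply/hasPn => _ /mapP[s _ ->]; apply/mapP => -[r _ [yx _]].
by rewrite yx eqxx in xy.
Qed.

(** With repeated letters the criterion fails: the copies of [u] and [v] inside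
    [t] could then overlap. *)
Lemma mem_shuffles u v t : uniq (u ++ v) ->
  (t \in shuffles u v) =
  [&& size t == size u + size v, subseq u t & subseq v t].
Proof.
have full (w s : seq T) : (s == w) = (size s == size w) && subseq w s.
  apply/eqP/andP => [->|[/eqP ss sub]]; first by rewrite eqxx subseq_refl.
  by apply/esym/eqP; rewrite -(size_subseq_leqif sub) ss.
have mem_cons z z' (s : seq T) (S : seq (seq T)) :
    (z :: s \in [seq z' :: r | r <- S]) = (z == z') && (s \in S).
  by apply/mapP/andP => [[r r_in [-> ->]]|[/eqP-> s_in]]; [|exists s].
elim: t u v => [|z t IHt] [|x u] [|y v] uv_uniq;
  rewrite ?shuffles0s ?shuffless0 ?inE ?sub0seq ?addn0 ?andbT ?full //.
  rewrite shuffles_cons mem_cat; apply/negbTE.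
  by apply/negP => /orP[] /mapP[].
have [xy yv_uniq xu_uniq] := uniq_cat_cons uv_uniq.
have -> : (size (z :: t) == size (x :: u) + size (y :: v)) =
          (size t == (size u + size v).+1) by rewrite addSn addnS.
rewrite shuffles_cons mem_cat !mem_cons (IHt _ _ yv_uniq) (IHt _ _ xu_uniq).
rewrite addSn addnS /= [x == z]eq_sym [y == z]eq_sym.
case: (eqVneq z x) => [->|zx].
  by rewrite (negPf xy) /= orbF.
case: (eqVneq z y) => //= zy.
(* A word made of fewer than [size u + size v + 2] letters cannot contain all
   the letters of [x :: u] and [y :: v]. *)
apply/esym/negbTE/negP => /and3P[/eqP size_t xut yvt].
have : size ((x :: u) ++ (y :: v)) <= size t.
  apply: uniq_leq_size uv_uniq _ => w; rewrite mem_cat.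
  by case/orP; apply: mem_subseq.
by rewrite size_cat size_t /=; lia.
Qed.

End Shuffles.

(** * Gaussian binomial coefficients *)

Local Open Scope ring_scope.
Local Notation q := ('X : {poly nat}).

(** The Gaussian binomial coefficient [m + n] choose [m]; indexing by the two
    complementary sizes avoids subtraction in Pascal's rules. *)
Fixpoint gauss (m n : nat) : {poly nat} :=
  if m is m'.+1 then
    (fix gauss_m n :=
       if n is n'.+1 then gauss m' n + q ^+ m * gauss_m n' else 1) n
  else 1.

Lemma gauss0n n : gauss 0 n = 1.
Proof. by []. Qed.

Lemma gaussn0 m : gauss m 0 = 1.
Proof. by case: m. Qed.

Lemma gaussSS m n :
  gauss m.+1 n.+1 = gauss m n.+1 + q ^+ m.+1 * gauss m.+1 n.
Proof. by []. Qed.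

(** The definition expands one form of Pascal's rule; the mirror form follows by
    expanding both terms once more, in opposite ways. *)
Lemma gaussSSr m n :
  gauss m.+1 n.+1 = q ^+ n.+1 * gauss m n.+1 + gauss m.+1 n.
Proof.
elim: m n => [|m IHm] n.
  elim: n => [|n IHn]; rewrite gaussSS !gauss0n ?gaussn0; first by ring.
  by rewrite {1}IHn gaussSS !gauss0n !exprS; ring.
elim: n => [|n IHn]; rewrite gaussSS {1}IHm.
  by rewrite !gaussn0 gaussSS !gaussn0 !exprS; ring.
rewrite {1}IHn (gaussSS m n.+1) (gaussSS m.+1 n) !exprS; ring.
Qed.

Lemma gaussC m n : gauss m n = gauss n m.
Proof.
elim: m n => [|m IHm] n; first by rewrite gaussn0.
elim: n => [|n IHn]; first by rewrite gaussn0.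
by rewrite gaussSS gaussSSr IHm IHn addrC.
Qed.

(** * The generating function of the major index over shuffles *)

(** The major index of the reversal of [s]. A letter [x] followed by [s'] in the
    reversed word comes at position [size s' + 1] of the word, and a descent to
    it has position [size s']. When [s'] is empty the default of [head] is
    harmless, since it is multiplied by [size s' = 0]. *)
Fixpoint rmaj (s : seq nat) : nat :=
  if s is x :: s' then ((x < head 0 s') * size s' + rmaj s')%N else 0.

Lemma rmaj_cons2 x y s :
  rmaj (x :: y :: s) = ((x < y) * (size s).+1 + rmaj (y :: s))%N.
Proof. by []. Qed.

Definition maj_gf (u v : seq nat) : {poly nat} :=
  \sum_(t <- shuffles u v) q ^+ rmaj t.

(** The share of [maj_gf (x :: u) v] due to the shuffles whose final letter is
    the [x] of the first word. *)
Definition maj_gf_last (x : nat) (u v : seq nat) : {poly nat} :=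
  \sum_(t <- shuffles u v) q ^+ rmaj (x :: t).

Lemma maj_gf_lastC x u v : maj_gf_last x u v = maj_gf_last x v u.
Proof. exact: perm_big (shufflesC u v). Qed.

Lemma maj_gf_cons x u y v :
  maj_gf (x :: u) (y :: v) =
  maj_gf_last x u (y :: v) + maj_gf_last y v (x :: u).
Proof.
rewrite [maj_gf_last y _ _]maj_gf_lastC /maj_gf shuffles_cons big_cat /=.
by rewrite !big_map.
Qed.

(** The letter before the final [z] is [x] or [y], and it alone decides whether
    a descent is created; such a descent has the same position [n] in both
    cases. *)
Lemma maj_gf_last_cons z x u y v :
  let n := (size u + size v).+2 in
  maj_gf_last z (x :: u) (y :: v) =
  q ^+ ((z < x) * n) * maj_gf_last x u (y :: v) +
  q ^+ ((z < y) * n) * maj_gf_last y v (x :: u).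
Proof.
rewrite [maj_gf_last y _ _]maj_gf_lastC /maj_gf_last shuffles_cons big_cat.
rewrite !big_map !mulr_sumr; congr (_ + _);
  by apply: eq_big_seq => t /perm_shuffles/perm_size size_t;
    rewrite -exprD /= size_t size_cat /= ?addnS ?addSn.
Qed.

(** The contributions of the shuffles ending in [x] and of those ending in [y],
    as they are when [y < x]: the extra power of [q] goes to the shuffles whose
    final letter is the smaller one. *)
Definition last_letter_law (x : nat) (u : seq nat) (y : nat) (v : seq nat) :=
  let w := (rmaj (x :: u) + rmaj (y :: v))%N in
  maj_gf_last x u (y :: v) = q ^+ w * gauss (size u) (size v).+1 /\
  maj_gf_last y v (x :: u) =
    q ^+ w * (q ^+ (size u).+1 * gauss (size u).+1 (size v)).

(** The two contributions add up by Pascal's rule. The law is about a first word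
    with the larger last letter; as the total is symmetric in the two words,
    either order of [x] and [y] gives the same formula. *)
Lemma maj_gf_of_last_letter_law x u y v :
    x != y ->
    ((y < x)%N -> last_letter_law x u y v) ->
    ((x < y)%N -> last_letter_law y v x u) ->
  maj_gf (x :: u) (y :: v) =
  q ^+ (rmaj (x :: u) + rmaj (y :: v)) * gauss (size u).+1 (size v).+1.
Proof.
rewrite maj_gf_cons neq_ltn => /orP[xy _|yx + _].
  move=> /(_ xy)[-> ->]; rewrite [in RHS]gaussC gaussSS [in RHS]addnC; ring.
by move=> /(_ yx)[-> ->]; rewrite gaussSS; ring.
Qed.

(** For the shuffles ending in [x], the preceding letter is [y], which creates
    no descent, or the predecessor [a] of [x] in its own word. If [a <= x] there
    is never a descent, and the total for the shorter words applies; if [x < a],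
    then [y < a] and the law holds for the shorter words. The shuffles ending
    in [y] are similar: before them comes [x], which always creates a descent,
    or the predecessor [b] of [y]. *)
Lemma last_letter_lawP x u y v : (y < x)%N ->
  ~~ has (mem (x :: u)) (y :: v) -> last_letter_law x u y v.
Proof.
have [n] := ubnP (size u + size v).
elim: n => // n IHn in x u y v *; rewrite ltnS => le_n yx dis.
have total a u' b v' : (size u' + size v' < n)%N ->
    ~~ has (mem (a :: u')) (b :: v') ->
  maj_gf (a :: u') (b :: v') =
  q ^+ (rmaj (a :: u') + rmaj (b :: v')) * gauss (size u').+1 (size v').+1.
  move=> lt_n dis'; apply: maj_gf_of_last_letter_law.
  - by apply: contraNneq dis' => -> /=; rewrite inE eqxx.
  - by move=> ba; apply: IHn.
  - by move=> ab; apply: IHn => //; rewrite 1?addnC // has_sym.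
split.
  case: u => [|a u] in le_n dis *.
    rewrite /maj_gf_last shuffles0s big_seq1 gauss0n mulr1 /=.
    by rewrite [(x < y)%N]ltnNge ltnW.
  have dis_u : ~~ has (mem (a :: u)) (y :: v).
    by apply: contra dis; apply: sub_has => z zu; apply/orP; right.
  rewrite maj_gf_last_cons [(x < y)%N]ltnNge (ltnW yx) mul0n mul1r.
  case: (ltnP x a) => [xa|ax].
    have [-> ->] : last_letter_law a u y v.
      by apply: IHn => //; apply: ltn_trans xa.
    rewrite [size (a :: u)]/= gaussSSr (rmaj_cons2 x) xa !mul1n.
    move: (rmaj _) (rmaj _) => i j; rewrite !(exprS, exprD); ring.
  rewrite mul1r -maj_gf_cons total //.
  by rewrite (rmaj_cons2 x) ltnNge ax.
case: v => [|b v] in le_n dis *.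
  rewrite /maj_gf_last shuffles0s big_seq1 gaussn0 mulr1 -exprD /=.
  by rewrite yx; congr (_ ^+ _); lia.
have dis_v : ~~ has (mem (x :: u)) (b :: v).
  by apply: contra dis => /= ->; rewrite orbT.
rewrite maj_gf_last_cons yx.
case: (ltnP y b) => [yb|b_y].
  (* Both possible predecessors of [y] create the same descent. *)
  rewrite -mulrDr addrC -maj_gf_cons total //; last by rewrite addnS in le_n.
  rewrite (rmaj_cons2 y) yb !mulrA -!exprD.
  by congr (_ ^+ _ * _) => /=; lia.
have [-> ->] : last_letter_law x u b v.
  by apply: IHn => //; [rewrite addnS in le_n|apply: leq_ltn_trans yx].
rewrite [size (b :: v)]/= gaussSSr (rmaj_cons2 y) [(y < b)%N]ltnNge b_y.
rewrite mul1n !mul0n add0n.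
move: (rmaj _) (rmaj _) => i j; rewrite !(exprS, exprD); ring.
Qed.

Lemma maj_gfE u v : ~~ has (mem u) v ->
  maj_gf u v = q ^+ (rmaj u + rmaj v) * gauss (size u) (size v).
Proof.
case: u v => [|x u] [|y v] dis;
  rewrite /maj_gf ?shuffles0s ?shuffless0 ?big_seq1 ?gaussn0 ?gauss0n ?addn0
          ?mulr1 //.
apply: maj_gf_of_last_letter_law => [|yx|xy].
- by apply: contraNneq dis => -> /=; rewrite inE eqxx.
- exact: last_letter_lawP.
- by apply: last_letter_lawP; rewrite // has_sym.
Qed.

(** * From reversed words to permutations *)

(** A multiset of naturals is determined by its generating polynomial, whose
    coefficients are the multiplicities. *)
Lemma perm_eq_sum_exp (s1 s2 : seq nat) :
  \sum_(k <- s1) q ^+ k = \sum_(k <- s2) q ^+ k -> perm_eq s1 s2.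
Proof.
have coefE (s : seq nat) k : (\sum_(i <- s) q ^+ i)`_k = count_mem k s.
  elim: s => [|i s IHs]; first by rewrite big_nil coef0.
  by rewrite big_cons coefD coefXn IHs /= natn eq_sym.
by move=> eq12; apply/allP => k _; rewrite /= -!coefE eq12.
Qed.

Lemma rmaj_rev (s : seq nat) :
  rmaj (rev s) = (\sum_(1 <= i < size s | nth 0 s i < nth 0 s i.-1) i)%N.
Proof.
elim/last_ind: s => [|s x IHs]; first by rewrite big_geq.
rewrite rev_rcons /= IHs size_rev size_rcons.
case/lastP: s {IHs} => [|s y]; first by rewrite !big_geq.
have nth_sy j : (j <= size s)%N ->
    nth 0%N (rcons (rcons s y) x) j = nth 0%N (rcons s y) j.
  by move=> le_j; rewrite nth_rcons size_rcons ltnS le_j.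
rewrite rev_rcons /= size_rcons [in RHS]big_mkcond big_nat_recr //=.
rewrite addnC; congr (_ + _)%N.
  rewrite big_mkcond; apply: eq_big_nat => i /andP[i_gt0 i_lt].
  by rewrite !nth_sy // (leq_trans (leq_pred i)).
rewrite (nth_sy (size s)) // !nth_rcons size_rcons !ltnn !eqxx ?size_rev.
by case: (x < y)%N; rewrite ?mul1n.
Qed.

Lemma maj_rmaj (p : permutation) : maj p = rmaj (rev p).
Proof.
rewrite rmaj_rev /= /maj_fun.
transitivity (\sum_(i <- [seq i <- iota 1 (size p).-1 |
                            nth 0 p i < nth 0 p i.-1]) i)%N; last first.
  by rewrite big_filter /index_iota subn1.
apply: perm_big; apply: uniq_perm;
  rewrite ?fset_uniq ?filter_uniq ?iota_uniq //.
by move=> i; rewrite in_fset /= mem_filter inE andbC.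
Qed.

Lemma disjoint_dom (p r : permutation) :
  (dom p `&` dom r = fset0)%fset -> ~~ has (mem (rev p)) (rev r).
Proof.
move=> dis; apply/hasPn => x; rewrite mem_rev => xr.
by apply/negP; rewrite /= mem_rev => xp; have := in_fset0 x;
  rewrite -dis in_fsetI !in_fset xr xp.
Qed.

Lemma perm_Sh (p r : permutation) : (dom p `&` dom r = fset0)%fset ->
  perm_eq [seq rev (word t) | t <- enum_fset (Sh p r)]
          (shuffles (rev p) (rev r)).
Proof.
have mem_dom (s : permutation) x : (x \in dom s) = (x \in rev s).
  by rewrite in_fset mem_rev.
have pos (s : permutation) : all (leq 1) s by case: s => s /= /andP[].
have uniq_rev (s : permutation) : uniq (rev s).
  by rewrite rev_uniq; case: s => s /= /andP[].
move=> dis; have uniq_pr : uniq (rev p ++ rev r).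
  rewrite cat_uniq !uniq_rev andbT; exact: disjoint_dom.
have mem_Sh (t : permutation) :
    (t \in Sh p r) = (rev t \in shuffles (rev p) (rev r)).
  rewrite in_Sh mem_shuffles // !subseq_rev.
  case: (boolP (subseq p t)) => [pt|]; last by rewrite !andbF.
  case: (boolP (subseq r t)) => [rt|]; last by rewrite !andbF.
  rewrite !andbT.
  have sub_t : {subset rev p ++ rev r <= rev t}.
    by move=> x; rewrite mem_cat !mem_rev => /orP[]; apply: mem_subseq.
  rewrite -size_cat; apply/eqP/eqP => [dom_t|/esym size_t].
    have eq_pr_t : rev p ++ rev r =i rev t.
      by move=> x; rewrite mem_cat -!mem_dom dom_t in_fsetU.
    by apply/eqP; rewrite -(uniq_size_uniq uniq_pr eq_pr_t) uniq_rev.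
  apply/fsetP => x; rewrite in_fsetU !mem_dom -mem_cat.
  by have [_ ->] := uniq_min_size uniq_pr sub_t (eq_leq (esym size_t)).
apply: uniq_perm.
- rewrite map_inj_uniq ?fset_uniq // => s t.
  by move/(can_inj revK)/val_inj.
- exact: uniq_shuffles.
move=> s; apply/mapP/idP => [[t t_in ->]|s_in]; first by rewrite -mem_Sh.
have s_word : uniq (rev s) && all (leq 1) (rev s).
  have s_pr := perm_shuffles s_in.
  rewrite rev_uniq (perm_uniq s_pr) uniq_pr all_rev (perm_all _ s_pr) all_cat.
  by rewrite !all_rev !pos.
exists (Permutation s_word); last by rewrite revK.
by rewrite mem_Sh /= revK.
Qed.

Theorem theorem5p2 : shuffle_compatible maj.
Proof.
have gf (p r : permutation) : (dom p `&` dom r = fset0)%fset ->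
    \sum_(k <- [seq maj t | t <- enum_fset (Sh p r)]) q ^+ k =
    q ^+ (maj p + maj r) * gauss (size p) (size r).
  move=> dis; rewrite big_map.
  under eq_bigr do rewrite maj_rmaj.
  rewrite -(big_map (fun t : permutation => rev (word t)) predT
                    (fun s => q ^+ rmaj s)).
  rewrite (perm_big _ (perm_Sh dis)) -/(maj_gf _ _) maj_gfE ?disjoint_dom //.
  by rewrite !maj_rmaj !size_rev.
move=> p p' r r' size_p size_r dis dis' maj_p maj_r.
apply/eq_seq_msetP/perm_eq_sum_exp.
by rewrite !gf // maj_p maj_r size_p size_r.
Qed.
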